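(* Let $t_0\in\mathbb{R}$, let $\ell_0,\ell_1\in V_{t_0}$, $\ell_0(1)(t)\ge\ell_1(1)(t)$ for a.e. $t\le t_0$, and let there exist $\kappa>0$ such that $f(v)(t)\ge0$ for a.e. $t\le t_0$ and every $v\in C_0(\mathbb{R};[0,\kappa])$. Let, moreover, there exist $\gamma\in AC_{loc}((-\infty,t_0];(0,+\infty))$ such that $\gamma'(t)\le-\ell_1(\gamma)(t)$ for a.e. $t\le t_0$ and $\gamma(-\infty)<+\infty$. Assume, further, that $c\in(0,\kappa)$ and $u$ is a solution to the problem $u'(t)=\ell_0(u)(t)-\ell_1(u)(t)+f(u)(t)$, $u(t_0)=c$, on $(-\infty,t_0]$ satisfying $0\le u(t)\le\kappa$ for $t\le t_0$ and having a limit $u(-\infty)$. If either $$\lim_{t\to-\infty}\int_t^{t_0}\ell_0(1)(s)\,ds=+\infty$$ or there exists $\omega\in\Sigma$ such that $f\in\mathcal{O}_{t_0}(\omega,\kappa,c)$, then $u(-\infty)=0$.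
   Context: Notation. $\mathbb{R}_+=[0,+\infty)$. $C_{loc}(\mathbb{R};\mathbb{R})$ is the space of continuous functions $\mathbb{R}\to\mathbb{R}$ with the topology of uniform convergence on every compact interval. $L_{loc}(\mathbb{R};\mathbb{R})$ is the space of locally Lebesgue-integrable functions on $\mathbb{R}$ with the topology of convergence in the mean on every compact interval. For $I,D\subseteq\mathbb{R}$: $C_0(I;D)$ is the set of bounded continuous functions $I\to D$; $AC_{loc}(I;D)$ is the set of functions $I\to D$ absolutely continuous on every compact interval contained in $I$; $L_{loc}(\mathbb{R};\mathbb{R}_+)$ is the set of functions $\mathbb{R}\to\mathbb{R}_+$ integrable on every compact interval. $u(-\infty)$ denotes the (finite or infinite) limit of $u$ at $-\infty$, if it exists. Standing assumptions. $\ell_0,\ell_1:C_{loc}(\mathbb{R};\mathbb{R})\to L_{loc}(\mathbb{R};\mathbb{R})$ are linear continuous operators which are positive (map non-negative functions to non-negative functions). $f:C_{loc}(\mathbb{R};\mathbb{R})\to L_{loc}(\mathbb{R};\mathbb{R})$ is a continuous operator satisfying the local Carathéodory conditions: for every $r>0$ there is $q_r\in L_{loc}(\mathbb{R};\mathbb{R}_+)$ with $|f(v)(t)|\le q_r(t)$ for a.e. $t\in\mathbb{R}$ whenever $\sup_{\mathbb{R}}|v|\le r$. If $I\subseteq\mathbb{R}$ is a closed interval, $u:I\to\mathbb{R}$ is continuous and $T:C_{loc}(\mathbb{R};\mathbb{R})\to L_{loc}(\mathbb{R};\mathbb{R})$ is a continuous operator, then $T(u):=T(\vartheta(u))$, where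 $\vartheta(u)$ is the extension of $u$ to $\mathbb{R}$ equal to $u(\inf I)$ to the left of $I$ (if $\inf I>-\infty$) and $u(\sup I)$ to the right of $I$ (if $\sup I<+\infty$). $T(1)$ is the value of $T$ at the constant function $1$. For $\tau\in\mathbb{R}$, $V_\tau$ is the set of continuous operators $T:C_{loc}(\mathbb{R};\mathbb{R})\to L_{loc}(\mathbb{R};\mathbb{R})$ such that for every $\zeta\le\tau$, $T(u)(t)=T(v)(t)$ for a.e. $t\le\zeta$ whenever $u,v\in C_{loc}(\mathbb{R};\mathbb{R})$ and $u=v$ on $(-\infty,\zeta]$. $\Sigma$ is the set of continuous $\omega:\mathbb{R}\to\mathbb{R}$ with $\omega(t)\le t$ for all $t$. For $\omega\in\Sigma$, $\tau\in\mathbb{R}$, $\kappa>0$, $c\in(0,\kappa)$, an operator $T:C_{loc}(\mathbb{R};\mathbb{R})\to L_{loc}(\mathbb{R};\mathbb{R})$ belongs to $\mathcal{O}_\tau(\omega,\kappa,c)$ if $$\limsup_{t\to-\infty}\int_{\omega(t)}^tT(u)(s)\,ds>0$$ whenever $u\in C_0(\mathbb{R};[0,\kappa])$ is such that $u(\tau)=c$, there exists a finite limit $u(-\infty)\le c$, and: $0<u(-\infty)\le u(t)$ for $t\le\tau$ if $u(-\infty)<c$; $u(t)=c$ for $t\le\tau$ if $u(-\infty)=c$. A solution of the equation on a closed interval $I$ is a function $u:I\to\mathbb{R}$ absolutely continuous on every compact interval contained in $I$ and satisfying the equation a.e. on $I$ (with $\ell_0(u),\ell_1(u),f(u)$ understood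 via the extension $\vartheta(u)$). *)

(* Defs.v *)
From HB Require Import structures.
From mathcomp Require Import all_boot all_order all_algebra.
From mathcomp Require Import all_classical all_reals all_analysis.
From mathcomp Require Import measurable_realfun.

Set Implicit Arguments.
Unset Strict Implicit.
Unset Printing Implicit Defensive.
Import Order.TTheory GRing.Theory Num.Theory.
Import numFieldNormedType.Exports.

Local Open Scope classical_set_scope.
Local Open Scope ring_scope.

(* C_loc(R;R): continuous functions, topology of uniform convergence on every
   compact interval *)

Record Cloc (R : realType) := MkCloc {
  Cloc_fun :> R -> R ;
  Cloc_cont : continuous Cloc_fun }.

Definition compact_itvs (R : realType) (K : set R) : Prop :=
  exists a b : R, K = `[a, b]%classic.

Definition Cloc_emb (R : realType) (u : Cloc R) :
  {family @compact_itvs R, R -> R} := Cloc_fun u.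

HB.instance Definition _ (R : realType) := gen_eqMixin (Cloc R).
HB.instance Definition _ (R : realType) := gen_choiceMixin (Cloc R).
HB.instance Definition _ (R : realType) :=
  Topological.copy (Cloc R) (initial_topology (@Cloc_emb R)).

(* L_loc(R;R): its elements are representatives, so equality in L_loc is
   equality almost everywhere and the topology below is not separated;
   measurable_fun is Borel measurability, which costs nothing since every
   Lebesgue measurable function is almost everywhere equal to a Borel one *)

Record Lloc (R : realType) := MkLloc {
  Lloc_fun :> R -> R ;
  Lloc_int : locally_integrable [set: R] Lloc_fun }.

Definition mean_dist (R : realType) (a b : R) (g h : R -> R) : R :=
  \int[@lebesgue_measure R]_(s in `[a, b]) `|g s - h s|.

Definition Lloc_nbhs (R : realType) (g : Lloc R) : set_system (Lloc R) :=
  [set A | exists a b e : R,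
     0 < e /\ forall h : Lloc R, mean_dist a b g h < e -> A h].

Section LlocTopology.
Variable R : realType.
Local Notation mu := (@lebesgue_measure R).
Implicit Types (g h k : Lloc R) (a b : R).

Lemma Lloc_integrable a b g : mu.-integrable `[a, b] (EFin \o g).
Proof.
case: g => g [mg _ ig] /=; apply/integrableP; split.
  exact/measurable_EFinP/measurable_funTS.
exact: ig (@segment_compact _ _ _).
Qed.

Lemma mean_dist_integrable a b g h :
  mu.-integrable `[a, b] (EFin \o (fun s => `|g s - h s|)).
Proof.
have ig := Lloc_integrable a b g; have ih := Lloc_integrable a b h.
have : mu.-integrable `[a, b] ((EFin \o g) \- (EFin \o h))%E.
  by apply: integrableB => //.
exact: integrable_norm.
Qed.

Lemma mean_distxx a b g : mean_dist a b g g = 0.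
Proof.
rewrite /mean_dist (@eq_Rintegral _ _ _ _ _ (cst 0)).
  by rewrite Rintegral_cst// mul0r.
by move=> s _; rewrite subrr normr0.
Qed.

Lemma mean_dist_triangle a b g h k :
  mean_dist a b g k <= mean_dist a b g h + mean_dist a b h k.
Proof.
have igh := mean_dist_integrable a b g h.
have ihk := mean_dist_integrable a b h k.
rewrite /mean_dist -RintegralD//.
apply: le_Rintegral => //.
- exact: mean_dist_integrable.
- exact: (integrableD _ igh ihk).
- move=> s _.
  rewrite -[X in `|X|](subrKA (h s)); exact: ler_normD.
Qed.

Lemma mean_dist_sub a b a' b' g h : a' <= a -> b <= b' ->
  mean_dist a b g h <= mean_dist a' b' g h.
Proof.
move=> aa bb; have igh := mean_dist_integrable a' b' g h.
have sub : `[a, b]%classic `<=` `[a', b']%classic.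
  by move=> s /=; rewrite !in_itv/= => /andP[as_ sb]; rewrite (le_trans aa as_) (le_trans sb bb).
apply: fine_le.
- exact: (integrable_fin_num _ (mean_dist_integrable a b g h)).
- exact: (integrable_fin_num _ igh).
- apply: ge0_subset_integral => //.
  by case/integrableP: igh.
Qed.

Fact Lloc_nbhs_filter g : ProperFilter (Lloc_nbhs g).
Proof.
split.
  by move=> [a [b [e [e0 /(_ g)]]]]; rewrite mean_distxx => /(_ e0).
split.
- by exists 0, 0, 1; split.
- move=> A B [a [b [e [e0 hA]]]] [a' [b' [e' [e'0 hB]]]].
  exists (Num.min a a'), (Num.max b b'), (Num.min e e').
  split=> [|h]; rewrite lt_min; first by rewrite e0.
  case/andP=> he he'; split.
  + by apply: hA; apply: le_lt_trans he; apply: mean_dist_sub;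
      rewrite ?ge_min ?le_max lexx.
  + by apply: hB; apply: le_lt_trans he'; apply: mean_dist_sub;
      rewrite ?ge_min ?le_max lexx orbT.
- move=> A B AB [a [b [e [e0 hA]]]]; exists a, b, e; split=> // h hh.
  exact/AB/hA.
Qed.

Fact Lloc_nbhs_singleton g (A : set (Lloc R)) : Lloc_nbhs g A -> A g.
Proof. by move=> [a [b [e [e0]]]]; apply; rewrite mean_distxx. Qed.

Fact Lloc_nbhs_nbhs g (A : set (Lloc R)) :
  Lloc_nbhs g A -> Lloc_nbhs g (fun h => Lloc_nbhs h A).
Proof.
move=> [a [b [e [e0 hA]]]]; exists a, b, e; split=> // h gh.
exists a, b, (e - mean_dist a b g h); rewrite subr_gt0; split=> // k hk.
apply: hA; apply: le_lt_trans (mean_dist_triangle a b g h k) _.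
by rewrite -ltrBrDl.
Qed.

End LlocTopology.

HB.instance Definition _ (R : realType) := gen_eqMixin (Lloc R).
HB.instance Definition _ (R : realType) := gen_choiceMixin (Lloc R).
HB.instance Definition _ (R : realType) := hasNbhs.Build (Lloc R) (@Lloc_nbhs R).
HB.instance Definition _ (R : realType) :=
  Nbhs_isNbhsTopological.Build (Lloc R) (@Lloc_nbhs_filter R)
    (@Lloc_nbhs_singleton R) (@Lloc_nbhs_nbhs R).

Fact Cloc_lin_subproof (R : realType) (a : R) (u v : Cloc R) :
  continuous (fun t => a * u t + v t).
Proof.
move=> t; have [ut vt] := (@Cloc_cont R u t, @Cloc_cont R v t).
exact: cvgD (cvgM (cvg_cst a) ut) vt.
Qed.

Definition Cloc_lin (R : realType) (a : R) (u v : Cloc R) : Cloc R :=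
  MkCloc (@Cloc_lin_subproof R a u v).

Definition Cloc_cst (R : realType) (k : R) : Cloc R :=
  MkCloc (fun t => @cst_continuous R R k t).

Definition linear_op (R : realType) (T : Cloc R -> Lloc R) : Prop :=
  forall (a : R) (u v : Cloc R), {ae @lebesgue_measure R, forall t,
    T (Cloc_lin a u v) t = a * T u t + T v t}.

Definition positive_op (R : realType) (T : Cloc R -> Lloc R) : Prop :=
  forall u : Cloc R, (forall t, 0 <= u t) ->
    {ae @lebesgue_measure R, forall t, 0 <= T u t}.

Definition local_caratheodory (R : realType) (T : Cloc R -> Lloc R) : Prop :=
  forall r : R, 0 < r -> exists q : Lloc R, (forall t, 0 <= q t) /\
    forall v : Cloc R, (forall t, `|v t| <= r) ->
      {ae @lebesgue_measure R, forall t, `|T v t| <= q t}.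

Definition volterra (R : realType) (tau : R) (T : Cloc R -> Lloc R) : Prop :=
  continuous T /\
  forall zeta : R, zeta <= tau -> forall u v : Cloc R,
    (forall t, t <= zeta -> u t = v t) ->
    {ae @lebesgue_measure R, forall t, t <= zeta -> T u t = T v t}.

Definition C0 (R : realType) (D : set R) (u : Cloc R) : Prop :=
  bounded_fun u /\ forall t, D (u t).

(* u(-oo) = l, finite or infinite *)
Definition limit_ninfty (R : realType) (u : R -> R) (l : \bar R) : Prop :=
  (u t)%:E @[t --> -oo] --> l.

Definition Sigma (R : realType) (omega : R -> R) : Prop :=
  continuous omega /\ forall t, omega t <= t.

Definition class_O (R : realType) (tau : R) (omega : R -> R) (kappa c : R)
    (T : Cloc R -> Lloc R) : Prop :=
  forall u : Cloc R, C0 `[0, kappa]%classic u -> u tau = c ->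
  (exists l : R, [/\ limit_ninfty u l%:E, l <= c,
     l < c -> 0 < l /\ forall t, t <= tau -> l <= u t &
     l = c -> forall t, t <= tau -> u t = c]) ->
  (0 < limf_esup (fun t : R =>
     \int[@lebesgue_measure R]_(s in `[omega t, t]) (T u s)%:E) (ninfty_nbhs R))%E.

(* Functions on the closed half-line (-oo, t0]: only the values at t <= t0
   matter below *)

Record Chalf (R : realType) (t0 : R) := MkChalf {
  Chalf_fun :> R -> R ;
  Chalf_cont : {within `]-oo, t0], continuous Chalf_fun} }.

Fact theta_subproof (R : realType) (t0 : R) (u : Chalf t0) :
  continuous (fun t => u (Num.min t t0)).
Proof.
have uc := (@subspace_continuousP _ _ _ _).1 (@Chalf_cont _ _ u).
have mc : continuous (fun t => Num.min t t0).
  by move=> t; apply: (@continuous_min R R id (cst t0) t);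
    [exact: (@cvg_id _ (nbhs t))|exact: (@cst_continuous R R t0 t)].
have mI t : `]-oo, t0]%classic (Num.min t t0).
  by rewrite /= in_itv/= ge_min lexx orbT.
move=> t; apply: (@cvg_comp _ _ _ (fun t => Num.min t t0) u _
  (within `]-oo, t0]%classic (nbhs (Num.min t t0)))); last exact/uc/mI.
move=> A /(mc t) /= At; apply: (@filterS _ (nbhs t)) At => s As.
exact: As (mI s).
Qed.

(* the extension of u to the whole line by the constant u(t0) *)
Definition theta (R : realType) (t0 : R) (u : Chalf t0) : Cloc R :=
  MkCloc (@theta_subproof R t0 u).

Definition abs_cont (R : realType) (a b : R) (u : R -> R) : Prop :=
  forall e : R, 0 < e -> exists2 d : R, 0 < d &
    forall (n : nat) (x y : 'I_n -> R),
      (forall i, [/\ a <= x i, x i <= y i & y i <= b]) ->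
      trivIset [set: 'I_n] (fun i => `]x i, y i[%classic) ->
      \sum_(i < n) (y i - x i) < d ->
      \sum_(i < n) `|u (y i) - u (x i)| < e.

Definition AC_loc (R : realType) (I : set R) (u : R -> R) : Prop :=
  forall a b : R, `[a, b]%classic `<=` I -> abs_cont a b u.

(* Almost every t <= t0 is an interior point of (-oo, t0], so the two-sided
   derivative at t does not depend on u beyond t0. *)
Definition solution (R : realType) (l0 l1 f : Cloc R -> Lloc R) (t0 : R)
    (u : Chalf t0) : Prop :=
  AC_loc `]-oo, t0]%classic u /\
  {ae @lebesgue_measure R, forall t, t <= t0 ->
    derivable (u : R -> R) t 1 /\
    derive1 u t = l0 (theta u) t - l1 (theta u) t + f (theta u) t}.

(* Main.v *)
Require Import Defs.
From mathcomp Require Import all_boot all_order all_algebra.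
From mathcomp Require Import all_classical all_reals all_analysis.
From mathcomp Require Import measurable_realfun lra.
Import Order.TTheory GRing.Theory Num.Theory.
Import numFieldNormedType.Exports.
Local Open Scope classical_set_scope.
Local Open Scope ring_scope.

(** Suppose that the limit [L] of [u] at [-oo] is positive. Three facts lead to
    a contradiction.

    First, no solution dips below its limit. Suppose that [u] attains its
    minimum [m >= 0] over the half-line at a point [tau]. Since
    [l0(1) >= l1(1)] and [f(u) >= 0], the function [u - m >= 0] satisfies
    [(u - m)' >= - l1(u - m)]. Let [lam] be the supremum of [(u - m) / gamma]
    on [(-oo, tau]]. Then [w = lam gamma - (u - m)] is nonnegative and
    [w' <= - l1(w) <= 0], so [w >= w(tau) = lam gamma(tau)]. As [gamma] is
    bounded, this says that [(u - m) / gamma] stays below a fixed fraction of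
    [lam], which forces [lam = 0]: [u] is constant to the left of [tau]
    ([minimum_propagates_left]). If [u] took a value below [L], it would have a
    minimum below [L], and would be equal to it near [-oo]; hence [u >= L]
    everywhere ([limit_le_supersolution]).

    Second, [gamma] pays for the delayed term [- l1(u)]. Since [gamma] is
    nonincreasing, [u <= kappa <= (kappa / gamma(t0)) gamma], so that
    [l1(u) <= (kappa / gamma(t0)) l1(gamma) <= - (kappa / gamma(t0)) gamma'].
    The function [F = u - (kappa / gamma(t0)) gamma] thus satisfies
    [F' >= l0(u) + f(u)], and it has a finite limit at [-oo] because [gamma]
    has one ([solution_corrected_integral_le]).

    Third, both alternatives contradict the convergence of [F]. If [l0(1)] has
    infinite integral, [F' >= l0(u) >= L l0(1)] makes [F] unbounded. If [f]
    belongs to the class [O], then [u] is one of the functions on which the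
    class is tested: [u >= L], and when [L = c] the value [c] is the minimum
    of [u] and is reached at [t0], so that [u] is constant. But the integral
    of [f(u)] from [omega t] to [t] is at most [F t - F (omega t)], which tends
    to [0].

    Passing from derivatives to increments needs the inequality half of the
    fundamental theorem of calculus for absolutely continuous functions
    ([AC_integral_le]), proved here from the elementary definition of absolute
    continuity. *)

(** * Absolutely continuous functions with a signed derivative *)

(** A form of Cousin's lemma: a property of intervals that passes to adjacent
    unions and holds on all small intervals around each point holds globally,
    because the supremum of the points reachable from [a] can always be passed
    unless it is [b]. *)
Lemma interval_additive_ind (R : realType) (P : R -> R -> Prop) (a b : R) :
  a <= b ->
  (forall x y z, x <= y -> y <= z -> P x y -> P y z -> P x z) ->
  (forall s, a <= s <= b -> exists2 h, 0 < h & forall x y,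
     a <= x -> y <= b -> s - h < x -> x <= s -> s <= y -> y < s + h -> P x y) ->
  P a b.
Proof.
move=> ab Padd Ploc.
pose S := [set t | a <= t <= b /\ P a t].
have Sa : S a.
  split; first by rewrite lexx ab.
  have [|h h0] := Ploc a; first by rewrite lexx ab.
  by apply; rewrite ?lexx// ?ltrDl// ltrBlDr ltrDl.
have Sb : has_ubound S by exists b => t [/andP[]].
have hS : has_sup S by split; [exists a|].
set s := sup S.
have as_ : a <= s by apply: ub_le_sup.
have sb : s <= b by apply: ge_sup; [exists a|move=> t [/andP[]]].
have [|h h0 Ph] := Ploc s; first by rewrite as_ sb.
have [t St st] := sup_adherent h0 hS.
have ts : t <= s by apply: ub_le_sup.
have [/andP[at_ tb] Pat] := St.
have Pas : P a s.
  by apply: (Padd _ t) => //; apply: Ph => //; rewrite ltrDl.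
move: sb; rewrite le_eqVlt => /orP[/eqP <-//|sb].
pose y := Num.min (s + h / 2) b.
have sy : s < y by rewrite /y lt_min sb andbT ltrDl divr_gt0.
have yb : y <= b by rewrite /y ge_min lexx orbT.
have ysh : y < s + h.
  rewrite /y gt_min; apply/orP; left; lra.
have /(ub_le_sup Sb) : S y.
  split; first by rewrite yb andbT (le_trans as_)// ltW.
  apply: (Padd _ s) => //; first exact: ltW.
  by apply: Ph => //; [rewrite ltrBlDr ltrDl|exact: ltW].
by rewrite -/s leNgt sy.
Qed.

Lemma measure_disjoint_itvs (R : realType) (n : nat) (x y : 'I_n -> R) :
  trivIset [set: 'I_n] (fun i => `]x i, y i[%classic) ->
  (forall i, x i <= y i) ->
  @lebesgue_measure R (\big[setU/set0]_(i < n) `]x i, y i[%classic) =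
  (\sum_(i < n) (y i - x i))%:E.
Proof.
move=> tr xy; rewrite measure_bigsetU_ord_cond//; last exact: sub_trivIset tr.
rewrite -sumEFin; apply: eq_bigr => i _.
transitivity (@lebesgue_measure R `]x i, y i[%classic) => //.
rewrite lebesgue_measure_itv/= lte_fin; case: ltP => // yx.
by rewrite (@le_anti _ _ (x i) (y i)) ?subrr// xy.
Qed.

Lemma sum_length_le_measure (R : realType) (U : set R) (s : seq (R * R)) :
  measurable U -> pairwise (fun p q : R * R => p.2 <= q.1) s ->
  (forall p, p \in s -> p.1 <= p.2 /\ `]p.1, p.2[%classic `<=` U) ->
  let I (i : 'I_(size s)) := nth (0, 0) s i in
  trivIset [set: 'I_(size s)] (fun i => `](I i).1, (I i).2[%classic) /\
  ((\sum_(i < size s) ((I i).2 - (I i).1))%:E <= @lebesgue_measure R U)%E.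
Proof.
move=> mU ps sU I.
have mem_I i : I i \in s by exact: mem_nth.
have disj (i j : 'I_(size s)) t : (i < j)%N ->
    t \in `](I i).1, (I i).2[ -> t \in `](I j).1, (I j).2[ -> False.
  move=> ij /andP[_ ti] /andP[tj _]; move/(pairwiseP (0, 0)): ps.
  move=> /(_ i j (ltn_ord i) (ltn_ord j) ij) /=.
  by rewrite leNgt (lt_trans (y := t)).
have tr : trivIset [set: 'I_(size s)] (fun i => `](I i).1, (I i).2[%classic).
  move=> i j _ _ [t [/= ti tj]]; apply: val_inj => /=.
  by case: (ltngtP i j) => // ij; [case: (disj _ _ _ ij ti tj)
                                  |case: (disj _ _ _ ij tj ti)].
split=> //.
rewrite -measure_disjoint_itvs//; last by move=> i; have [] := sU _ (mem_I i).
apply: le_measure; rewrite ?inE//.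
  exact: bigsetU_measurable.
apply: (big_ind (fun A => A `<=` U)) => // [A B AU BU|i _].
  by rewrite subUset.
by have [_] := sU _ (mem_I i); apply.
Qed.

(** Cover the null set of bad points by an open set [U] of small measure. Around
    a point of [U] take an interval inside [U]; around any other point the
    derivative is nonnegative, so [F] decreases by at most [e'] times the
    length. Gluing these intervals, the total decrease of [F] is at most
    [e' (b - a)] plus the variation of [F] on finitely many disjoint intervals
    inside [U], which absolute continuity makes small. *)
Lemma AC_ge0_derive_le (R : realType) (F : R -> R) (a b : R) :
  a <= b -> abs_cont a b F ->
  {ae @lebesgue_measure R, forall t, a < t -> t < b ->
     derivable F t 1 /\ 0 <= derive1 F t} ->
  F a <= F b.
Proof.
move=> ab acF aeF; apply/ler_addgt0Pl => e e0.
have [d d0 Fd] := acF _ (divr_gt0 e0 (ltr0n R 2)).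
pose e' := e / 2 / (b - a + 1).
have ba1 : 0 < b - a + 1 by rewrite ltr_wpDl ?subr_ge0.
have e'0 : 0 < e' by rewrite !divr_gt0.
(* The endpoints, where nothing is known of the derivative, count as bad. *)
pose bad := ~` [set t | a < t -> t < b -> derivable F t 1 /\ 0 <= derive1 F t]
  `|` [set a] `|` [set b].
have [N [mN N0 badN]] : (@lebesgue_measure R).-negligible bad.
  apply: negligibleU; first apply: negligibleU => //.
    by apply/negligibleP => //; exact: lebesgue_measure_set1.
  by apply/negligibleP => //; exact: lebesgue_measure_set1.
have [|U [oU NU Ud]] := @lebesgue_regularity_outer R N d mN _ d0.
  by rewrite [X in (X < _)%E]N0.
have mU : measurable U by exact: open_measurable.
have {}Ud : (@lebesgue_measure R U < d%:E)%E.
  rewrite -(setDUK NU); apply: le_lt_trans Ud.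
  rewrite measureU ?setDIK//; last exact: measurableD.
  by rewrite [X in (X + _)%E]N0 add0e.
(* [s] lists, in increasing order, the pieces of [x, y] that lie in [U]. *)
pose P x y := exists s : seq (R * R),
  [/\ pairwise (fun p q : R * R => p.2 <= q.1) s,
   forall p, p \in s -> [/\ x <= p.1, p.1 <= p.2, p.2 <= y &
                        `]p.1, p.2[%classic `<=` U]
   & F x - F y <= e' * (y - x) + \sum_(p <- s) `|F p.2 - F p.1|].
have [s [pw sU Fs]] : P a b.
  apply: interval_additive_ind => //.
    move=> x y z xy yz [s [pw sU Fs]] [s' [pw' sU' Fs']].
    exists (s ++ s'); split.
    - rewrite pairwise_cat pw pw' !andbT; apply/allrelP => p q ps qs'.
      have [_ _ py _] := sU _ ps; have [yq _ _ _] := sU' _ qs'.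
      exact: le_trans yq.
    - move=> p; rewrite mem_cat => /orP[/sU|/sU'][xp pp py pU]; split => //.
        exact: le_trans yz.
      exact: le_trans xp.
    - rewrite big_cat/=; lra.
  move=> s /andP[as_ sb]; have [sU|sU] := pselect (U s).
    have [h /= h0 hU] : nbhs_ball s U by apply/nbhs_ballP; exact: open_nbhs_nbhs.
    exists h => // x y ax yb shx xs sy ysh; exists [:: (x, y)]; split => //.
    - move=> p; rewrite inE => /eqP -> /=; split => //.
        exact: le_trans sy.
      move=> t /=; rewrite in_itv/= => /andP[xt ty].
      by apply: hU; rewrite /ball/= ltr_distlC; apply/andP; split; lra.
    - rewrite big_seq1/= -normrN opprB.
      apply: (le_trans (ler_norm _)); rewrite lerDr.
      by rewrite mulr_ge0 ?(ltW e'0)// subr_ge0 (le_trans xs).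
  have : ~ bad s by move=> /badN/NU.
  move=> /not_orP[/not_orP[/contrapT/= Fs sa] sb'].
  have {as_ sa}as_ : a < s by rewrite lt_neqAle as_ andbT; apply/eqP => /esym.
  have {sb sb'}sb : s < b by rewrite lt_neqAle sb andbT; apply/eqP.
  have {Fs}[dF F0] := Fs as_ sb.
  have /cvgrPdist_lt /(_ _ e'0) : h^-1 *: (F (h + s) - F s) @[h --> 0^'] --> derive1 F s.
    by rewrite derive1E /derive; move: dF; rewrite /derivable; 
      under eq_fun do rewrite [_%:A]mulr1.
  rewrite -nbhs_nearE => -[h /= h0 hF].
  (* Multiplying by the sign of [k] treats both sides of [s] at once. *)
  have step k : `|k| < h -> - (e' * `|k|) <= Num.sg k * (F (k + s) - F s).
    move=> kh; have [->|k0] := eqVneq k 0; first by rewrite normr0 sgr0 mulr0 mul0r oppr0.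
    have := hF k; rewrite /ball_/= sub0r normrN => /(_ kh k0).
    rewrite ltr_distlC => /andP[+ _].
    rewrite {1}(numEsg k) => le1.
    have nk : 0 < `|k| by rewrite normr_gt0.
    have {}le1 : - e' < (Num.sg k * `|k|)^-1 *: (F (k + s) - F s).
      by apply: le_lt_trans le1; rewrite lerDr.
    rewrite -(@ler_pM2l _ `|k|^-1) ?invr_gt0//.
    rewrite mulrN mulrCA mulVf ?gt_eqF// mulr1; apply/ltW/(lt_le_trans le1).
    have -> : (Num.sg k * `|k|)^-1 = Num.sg k * `|k|^-1.
      by rewrite invfM; congr (_ * _); case: sgrP k0; rewrite ?invr1 ?invrN1.
    by rewrite /GRing.scale/= mulrCA mulrA.
  exists h => // x y ax yb shx xs sy ysh; exists [::]; split => //.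
  rewrite big_nil addr0.
  have sy' : - (e' * (y - s)) <= F y - F s.
    move: sy; rewrite le_eqVlt => /orP[/eqP <-|sy]; first by rewrite !subrr mulr0 oppr0.
    have := step (y - s); rewrite gtr0_norm ?subr_gt0// gtr0_sg ?subr_gt0// mul1r subrK.
    by apply; lra.
  have sx' : - (e' * (s - x)) <= F s - F x.
    move: xs; rewrite le_eqVlt => /orP[/eqP <-|xs]; first by rewrite !subrr mulr0 oppr0.
    have := step (x - s); rewrite ltr0_norm ?subr_lt0// ltr0_sg ?subr_lt0// subrK !opprB mulN1r opprB.
    by apply; lra.
  lra.
have [|tr sl] := @sum_length_le_measure R U s mU pw.
  by move=> p /sU[].
have := Fd _ (fun i => (nth (0, 0) s i).1) (fun i => (nth (0, 0) s i).2) _ tr.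
rewrite -lte_fin (le_lt_trans sl Ud) => /(_ _ isT) Fd'.
have {}Fd' : \sum_(p <- s) `|F p.2 - F p.1| < e / 2.
  rewrite (big_nth (0, 0)) big_mkord; apply: Fd' => i.
  by have [] := sU (nth (0, 0) s i) (mem_nth _ (ltn_ord i)).
have : e' * (b - a) <= e / 2.
  rewrite /e' mulrAC ler_pdivrMr// ler_pM2l ?divr_gt0//; lra.
by lra.
Qed.

Lemma abs_cont_linear (R : realType) (a b k : R) (F G : R -> R) :
  abs_cont a b F -> abs_cont a b G -> abs_cont a b (fun t => k * F t + G t).
Proof.
move=> acF acG e e0; have k1 : 0 < `|k| + 1 by rewrite ltr_wpDl.
have e2 : 0 < e / 2 by rewrite divr_gt0.
have [d d0 Fd] := acF _ (divr_gt0 e2 k1); have [d' d'0 Gd] := acG _ e2.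
exists (Num.min d d'); first by rewrite lt_min d0.
move=> n x y xy tr; rewrite lt_min => /andP[/(Fd n x y xy tr) Fe /(Gd n x y xy tr) Ge].
apply: (@le_lt_trans _ _ (\sum_(i < n) (`|k| * `|F (y i) - F (x i)| +
                                      `|G (y i) - G (x i)|))).
  apply: ler_sum => i _; rewrite opprD addrACA -mulrBr -normrM.
  exact: ler_normD.
rewrite big_split/= -mulr_sumr (splitr e); apply: ler_ltD => //.
rewrite ltr_pdivlMr// in Fe; apply: le_trans (ltW Fe).
by rewrite mulrC ler_wpM2l ?sumr_ge0// lerDl.
Qed.

Lemma abs_cont_cst (R : realType) (a b k : R) : abs_cont a b (fun=> k).
Proof.
move=> e e0; exists 1 => // n x y _ _ _.
by rewrite big1// => i _; rewrite subrr normr0.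
Qed.

(** Lets [filterS] and its variants resolve the almost-everywhere filter. *)
Local Instance lebesgue_ae_filter (R : realType) :
  Filter (nbhs (almost_everywhere (@lebesgue_measure R))).
Proof. exact: (ae_filter_ringOfSetsType (@lebesgue_measure R)). Qed.

Lemma AC_le0_derive_ge (R : realType) (F : R -> R) (a b : R) :
  a <= b -> abs_cont a b F ->
  {ae @lebesgue_measure R, forall t, a < t -> t < b ->
     derivable F t 1 /\ derive1 F t <= 0} ->
  F b <= F a.
Proof.
move=> ab acF aeF; rewrite -lerN2.
apply: (@AC_ge0_derive_le R (\- F)) => //.
  have -> : \- F = (fun t => -1 * F t + 0) by apply/funext => t /=; lra.
  by apply: abs_cont_linear => //; exact: abs_cont_cst.
apply: filterS aeF => t Ft at_ tb; have [dF F0] := Ft at_ tb.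
split; first exact: derivableN.
by rewrite derive1E deriveN// -derive1E oppr_ge0.
Qed.

Lemma Lloc_uniform_integrable (R : realType) (h : Lloc R) (a b e : R) : 0 < e ->
  exists2 d : R, 0 < d & forall A : set (measurableTypeR R), measurable A -> A `<=` `[a, b]%classic ->
    (@lebesgue_measure R A < d%:E)%E ->
    \int[@lebesgue_measure R]_(s in A) `|h s| < e.
Proof.
move=> e0.
have : (@lebesgue_measure R).-integrable setT (EFin \o (h \_ `[a, b])).
  rewrite -restrict_EFin; apply/integrable_restrict => //=; rewrite setTI.
  exact: Lloc_integrable.
move=> /integral_normr_continuous/(_ _ e0)[d [d0 hd]]; exists d => // A mA Aab Ad.
apply: le_lt_trans (hd A mA Ad); rewrite le_eqVlt; apply/orP; left; apply/eqP.
by apply: eq_Rintegral => s; rewrite inE => As; rewrite patchE mem_set//; exact: Aab.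
Qed.

Lemma Lloc_integrableS (R : realType) (h : Lloc R) (a b : R)
    (A : set (measurableTypeR R)) : measurable A -> A `<=` `[a, b]%classic ->
  (@lebesgue_measure R).-integrable A (EFin \o h).
Proof.
by move=> mA Aab; apply: (integrableS _ mA Aab (Lloc_integrable a b h)).
Qed.

(** Increments over disjoint intervals add up to an integral over their union,
    a set of small measure. *)
Lemma abs_cont_integral (R : realType) (h : Lloc R) (a b : R) :
  abs_cont a b (fun x => \int[@lebesgue_measure R]_(s in `[a, x]) h s).
Proof.
move=> e e0; have [d d0 hd] := Lloc_uniform_integrable _ h a b _ e0.
exists d => // n x y xy tr sd.
set mu := @lebesgue_measure R.
pose A : set (measurableTypeR R) := \big[setU/set0]_(i < n) `]x i, y i[%classic.
have mA : measurable A by apply: bigsetU_measurable.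
have Aab : A `<=` `[a, b]%classic.
  apply: (big_ind (fun A => A `<=` `[a, b]%classic)) => // [B C ? ?|i _ t /=].
    by rewrite subUset.
  have [ax _ yb] := xy i; rewrite !in_itv/= => /andP[xt ty].
  by rewrite (le_trans ax (ltW xt)) (le_trans (ltW ty) yb).
apply: le_lt_trans (hd A mA Aab _); last first.
  by rewrite measure_disjoint_itvs ?lte_fin// => i; have [] := xy i.
have inh (B : set (measurableTypeR R)) : measurable B -> B `<=` `[a, b]%classic ->
    mu.-integrable B (EFin \o (fun s => `|h s|)).
  by move=> mB Bab; apply: integrable_norm; exact: Lloc_integrableS Bab.
have sub i : `]x i, y i[%classic `<=` `[a, b]%classic.
  have [ax _ yb] := xy i; move=> t /=; rewrite !in_itv/= => /andP[xt ty].
  by rewrite (le_trans ax (ltW xt)) (le_trans (ltW ty) yb).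
have -> : \int[mu]_(s in A) `|h s| =
    \sum_(i < n) \int[mu]_(s in `]x i, y i[) `|h s|.
  apply/EFin_inj; rewrite -sumEFin /Rintegral fineK; last first.
    exact: (integrable_fin_num _ (inh A mA Aab)).
  rewrite ge0_integral_bigsetU ?index_enum_uniq//; last 2 first.
    exact: sub_trivIset tr.
    by apply: measurable_int; exact: inh.
  apply: eq_bigr => i _; rewrite fineK//.
  by apply: integrable_fin_num => //; exact: inh.
apply: ler_sum => i _; have [ax xyi yb] := xy i.
rewrite Rintegral_itvB ?bnd_simp//; last first.
  by apply: (@Lloc_integrableS R h a b) => //; apply: subset_itvl; rewrite bnd_simp.
rewrite -Rintegral_itv_bndo_bndc; last exact: Lloc_integrableS (sub i).
by apply: le_normr_Rintegral => //; exact: Lloc_integrableS (sub i).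
Qed.

(** [F] minus the primitive of [h] is absolutely continuous with an almost
    everywhere nonnegative derivative, by Lebesgue differentiation. *)
Lemma AC_integral_le (R : realType) (F : R -> R) (h : Lloc R) (a b : R) :
  a <= b -> abs_cont a b F ->
  {ae @lebesgue_measure R, forall t, a < t -> t < b ->
     derivable F t 1 /\ h t <= derive1 F t} ->
  \int[@lebesgue_measure R]_(s in `[a, b]) h s <= F b - F a.
Proof.
move=> ab acF aeF.
pose G x := \int[@lebesgue_measure R]_(s in `[a, x]) h s.
have Ga : G a = 0 by rewrite /G set_itv1 Rintegral_set1.
have aeG : {ae @lebesgue_measure R, forall t, a < t ->
    derivable G t 1 /\ derive1 G t = h t}.
  have := @FTC1 R h (BLeft a) (fun y => Lloc_integrable a y h) (Lloc_int h).
  by apply: filterS => t /=; rewrite lte_fin.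
suff : (F \- G) a <= (F \- G) b by rewrite /= Ga -/(G b); lra.
apply: AC_ge0_derive_le => //.
  have -> : F \- G = (fun t => -1 * G t + F t) by apply/funext => t /=; lra.
  by apply: abs_cont_linear => //; exact: abs_cont_integral.
apply: filterS2 aeF aeG => t Ft Gt at_ tb.
have [dF hF] := Ft at_ tb; have [dG hG] := Gt at_.
split; first exact: derivableB.
by rewrite derive1E deriveB// -!derive1E hG subr_ge0.
Qed.

(** * Positive linear Volterra operators *)

Lemma thetaE (R : realType) (t0 : R) (u : Chalf t0) (t : R) :
  t <= t0 -> theta u t = u t.
Proof. by move=> tt0; rewrite /= min_l. Qed.

(** Freezing [w] after [tau] turns a sign condition on [(-oo, tau]] into one on
    the whole line, as positivity of an operator requires, while a Volterra
    operator does not see the change before [tau]. *)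
Definition Cloc_stop {R : realType} (tau : R) (w : Cloc R) : Cloc R :=
  theta (MkChalf (@continuous_subspaceT _ _ `]-oo, tau]%classic _ (@Cloc_cont R w))).

Definition volterra_positive {R : realType} (t0 : R) (T : Cloc R -> Lloc R) :=
  [/\ linear_op T, positive_op T & volterra t0 T].

(** Stated with three functions because the comparison argument applies it to
    [lam gamma - u + m]. *)
Lemma volterra_positive_comb (R : realType) (t0 : R) (T : Cloc R -> Lloc R)
    (tau a b d : R) (v w z : Cloc R) :
  volterra_positive t0 T -> tau <= t0 ->
  (forall t, t <= tau -> 0 <= a * v t + (b * w t + d * z t)) ->
  {ae @lebesgue_measure R, forall t, t <= tau ->
     0 <= a * T v t + (b * T w t + d * T z t)}.
Proof.
move=> [Tlin Tpos [_ Tvol]] taut0 H.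
(* [Cloc_lin] leaves its last argument unscaled, whence [d - 1]. *)
pose X := Cloc_lin (d - 1) z z.
pose Y := Cloc_lin b w X.
pose W := Cloc_lin a v Y.
have Wtau : {ae @lebesgue_measure R, forall t, 0 <= T (Cloc_stop tau W) t}.
  apply: Tpos => t; rewrite /=.
  have /H : Num.min t tau <= tau by rewrite ge_min lexx orbT.
  by set m := Num.min t tau; lra.
have TW := Tvol tau taut0 W (Cloc_stop tau W) _.
have {}TW := TW (fun t tt => esym (congr1 W (min_l tt))).
have TX := Tlin (d - 1) z z; have TY := Tlin b w X; have TV := Tlin a v Y.
apply: filterS2 (filterI Wtau TW) (filterI TX (filterI TY TV)).
move=> t [W0 Wt] [Xt [Yt Vt]] tt.
have := W0; rewrite -Wt// Vt Yt Xt; lra.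
Qed.

Lemma volterra_positive_le (R : realType) (t0 : R) (T : Cloc R -> Lloc R)
    (tau a b : R) (v w : Cloc R) :
  volterra_positive t0 T -> tau <= t0 ->
  (forall t, t <= tau -> a * v t <= b * w t) ->
  {ae @lebesgue_measure R, forall t, t <= tau -> a * T v t <= b * T w t}.
Proof.
move=> VT taut0 H.
have H' t : t <= tau -> 0 <= - a * v t + (b * w t + 0 * v t) by move=> /H; lra.
have := @volterra_positive_comb R t0 T tau (- a) b 0 v w v VT taut0 H'.
by apply: filterS => t /[swap] tt /(_ tt); lra.
Qed.

(** * Comparison with the decreasing function gamma *)

Definition decay_witness {R : realType} {t0 : R} (l1 : Cloc R -> Lloc R)
    (gamma : Chalf t0) :=
  [/\ AC_loc `]-oo, t0]%classic gamma,
     forall t, t <= t0 -> 0 < gamma t &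
     {ae @lebesgue_measure R, forall t, t <= t0 ->
        derivable (gamma : R -> R) t 1 /\
        derive1 gamma t <= - l1 (theta gamma) t}].

Lemma itvcc_sub_Nyc (R : realType) (a b t0 : R) : b <= t0 ->
  `[a, b]%classic `<=` `]-oo, t0]%classic.
Proof.
by move=> bt0 t /=; rewrite !in_itv/= => /andP[_ tb]; exact: le_trans bt0.
Qed.

Lemma decay_witness_antitone (R : realType) (t0 : R) (l1 : Cloc R -> Lloc R)
    (gamma : Chalf t0) (s t : R) :
  volterra_positive t0 l1 -> decay_witness l1 gamma -> s <= t -> t <= t0 ->
  gamma t <= gamma s.
Proof.
move=> l1P [acg g0 dg] st tt0.
apply: AC_le0_derive_ge => //; first by apply: acg; exact: itvcc_sub_Nyc.
have H r : r <= t0 -> 0 * theta gamma r <= 1 * theta gamma r.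
  by move=> rt0; rewrite thetaE// mul0r mul1r ltW// g0.
have {H}l1g := @volterra_positive_le R t0 l1 t0 0 1 _ _ l1P (lexx _) H.
apply: filterS2 dg l1g => r dg l1g _ /ltW rt.
have rt0 := le_trans rt tt0; have [? dg'] := dg rt0.
by split=> //; have := l1g rt0; lra.
Qed.

(** Nonnegativity of [f(u)] turns every solution into a supersolution of the
    linear equation, which is all that comparison needs. *)
Definition supersolution {R : realType} {t0 : R} (l0 l1 : Cloc R -> Lloc R)
    (u : Chalf t0) :=
  AC_loc `]-oo, t0]%classic u /\
  {ae @lebesgue_measure R, forall t, t <= t0 ->
     derivable (u : R -> R) t 1 /\
     l0 (theta u) t - l1 (theta u) t <= derive1 u t}.

(** With [lam] the supremum of [(u - m) / gamma] on [(-oo, tau]], the function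
    [lam gamma - u] is nonincreasing there: its derivative is at most
    [- l1 (lam gamma - u + m) - l0 (u - m) + m (l1 1 - l0 1)], a sum of
    nonpositive terms. Comparing with its value at [tau] gives
    [u - m <= lam (1 - gamma tau / G) gamma], so [lam] cannot be positive. *)
Lemma minimum_propagates_left (R : realType) (t0 : R) (l0 l1 : Cloc R -> Lloc R)
    (gamma u : Chalf t0) (G m M tau : R) :
  volterra_positive t0 l0 -> volterra_positive t0 l1 ->
  {ae @lebesgue_measure R, forall t, t <= t0 ->
     l1 (Cloc_cst 1) t <= l0 (Cloc_cst 1) t} ->
  decay_witness l1 gamma -> (forall t, t <= t0 -> gamma t <= G) ->
  supersolution l0 l1 u ->
  0 <= m -> (forall t, t <= t0 -> m <= u t <= M) ->
  tau <= t0 -> u tau = m ->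
  forall t, t <= tau -> u t = m.
Proof.
move=> l0P l1P l10 gP gG [acu du] m0 mu taut0 utau t1 t1tau.
have [acg g0 dg] := gP.
have ganti := @decay_witness_antitone R t0 l1 gamma _ _ l1P gP.
have le_t0 t : t <= tau -> t <= t0 by move=> /le_trans; exact.
apply/eqP; rewrite eq_le andbC; have /andP[-> /= _] := mu _ (le_t0 _ t1tau).
rewrite leNgt; apply/negP => mt1.
pose S := [set (u t - m) / gamma t | t in [set t | t <= tau]].
have supS : has_sup S.
  split; first by exists ((u t1 - m) / gamma t1), t1.
  exists ((M - m) / gamma tau) => _ [t /= tt <-].
  have /andP[mt tM] := mu _ (le_t0 _ tt).
  apply: ler_pM; rewrite ?subr_ge0//.
  - by rewrite invr_ge0 ltW// g0// le_t0.
  - by rewrite lerD2r.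
  - by rewrite lef_pV2 ?posrE ?g0 ?le_t0// ganti// le_t0.
set lam := sup S.
have S_lam t : t <= tau -> u t - m <= lam * gamma t.
  move=> tt; rewrite -ler_pdivrMr ?g0 ?le_t0//.
  by apply: ub_le_sup; [exact: supS.2|exists t].
have lam0 : 0 < lam.
  rewrite -(pmulr_lgt0 _ (g0 _ (le_t0 _ t1tau))).
  by apply: lt_le_trans (S_lam _ t1tau); rewrite subr_gt0.
have key t : t <= tau -> lam * gamma tau - u tau <= lam * gamma t - u t.
  move=> tt.
  pose w := lam \*: (gamma : R -> R) - (u : R -> R).
  suff : w tau <= w t by [].
  have sub := @itvcc_sub_Nyc R t tau t0 taut0.
  apply: AC_le0_derive_ge => //.
    have -> : w = (fun t => -1 * u t + (lam * gamma t + 0)).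
      apply/funext => r; have -> : w r = lam * gamma r - u r by [].
      by lra.
    apply: abs_cont_linear; first exact: acu.
    by apply: abs_cont_linear; [exact: acg|exact: abs_cont_cst].
  have W0 r : r <= tau -> 0 <= lam * theta gamma r +
      (-1 * theta u r + m * Cloc_cst 1 r).
    move=> rt; rewrite !thetaE ?le_t0//.
    by have := S_lam r rt; rewrite /=; lra.
  have l1W := @volterra_positive_comb R t0 l1 tau lam (-1) m _ _ _ l1P taut0 W0.
  have U0 r : r <= t0 -> m * Cloc_cst 1 r <= 1 * theta u r.
    by move=> rt; rewrite thetaE//=; have /andP[] := mu r rt; lra.
  have l0U := @volterra_positive_le R t0 l0 t0 m 1 _ _ l0P (lexx _) U0.
  apply: filterS2 (filterI dg du) (filterI l1W (filterI l0U l10)).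
  move=> r [dgr dur] [l1Wr [l0Ur l10r]] tr /ltW rtau.
  have rt0 := le_t0 _ rtau.
  have [dg1 dg2] := dgr rt0; have [du1 du2] := dur rt0.
  have dlg : derivable (lam \*: (gamma : R -> R)) r 1 by exact: derivableZ.
  split; first exact: derivableB.
  rewrite derive1E deriveB// deriveZ// -!derive1E /GRing.scale/=.
  have e1 := l1Wr rtau; have e2 := l0Ur rt0.
  have e3 := ler_wpM2l m0 (l10r rt0).
  have e4 := ler_wpM2l (ltW lam0) dg2.
  lra.
have G0 : 0 < G by apply: lt_le_trans (gG _ taut0); exact: g0.
pose q := 1 - gamma tau / G.
have : lam <= lam * q.
  apply: ge_sup; first exact: supS.1.
  move=> _ [t /= tt <-].
  have gt0 := g0 _ (le_t0 _ tt).
  rewrite ler_pdivrMr//.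
  have e1 := key t tt; rewrite utau in e1.
  have e2 : gamma tau / G * gamma t <= gamma tau.
    rewrite mulrAC -mulrA ler_piMr ?(ltW (g0 _ taut0))//.
    by rewrite ler_pdivrMr// mul1r gG// le_t0.
  have := ler_wpM2l (ltW lam0) e2; rewrite /q; lra.
have := mulr_gt0 lam0 (divr_gt0 (g0 _ taut0) G0).
rewrite /q; lra.
Qed.

(** * Behaviour of solutions at minus infinity *)

Lemma limit_ninfty_ge (R : realType) (phi : R -> R) (l : \bar R) (a tau : R) :
  limit_ninfty phi l -> (forall t, t <= tau -> a <= phi t) -> (a%:E <= l)%E.
Proof.
move=> phil H; apply: cvge_ge phil; exists tau; split=> [|t /ltW tt].
  exact: num_real.
by rewrite lee_fin H.
Qed.

Lemma limit_ninfty_le (R : realType) (phi : R -> R) (l : \bar R) (b tau : R) :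
  limit_ninfty phi l -> (forall t, t <= tau -> phi t <= b) -> (l <= b%:E)%E.
Proof.
move=> phil H; apply: cvge_le phil; exists tau; split=> [|t /ltW tt].
  exact: num_real.
by rewrite lee_fin H.
Qed.

(** A value below the limit yields a global minimum below the limit, since [u]
    exceeds that value near [-oo] and the rest of the half-line is compact.
    The minimum propagates to the left up to [-oo], where it contradicts the
    limit. *)
Lemma limit_le_supersolution (R : realType) (t0 : R) (l0 l1 : Cloc R -> Lloc R)
    (gamma u : Chalf t0) (G M L : R) :
  volterra_positive t0 l0 -> volterra_positive t0 l1 ->
  {ae @lebesgue_measure R, forall t, t <= t0 ->
     l1 (Cloc_cst 1) t <= l0 (Cloc_cst 1) t} ->
  decay_witness l1 gamma -> (forall t, t <= t0 -> gamma t <= G) ->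
  supersolution l0 l1 u -> (forall t, t <= t0 -> 0 <= u t <= M) ->
  u t @[t --> -oo] --> L ->
  forall t, t <= t0 -> L <= u t.
Proof.
move=> l0P l1P l10 gP gG uP u0M uL t1 t1t0.
rewrite leNgt; apply/negP => u1L.
have [K [_ Ku]] : \forall t \near -oo, u t1 < u t by exact: cvgr_gt uL _ u1L.
pose T := Num.min K t1.
have TK : T <= K by rewrite ge_min lexx.
have Tt1 : T <= t1 by rewrite ge_min lexx orbT.
have Tt0 : T <= t0 by exact: le_trans t1t0.
have [|s /[!in_itv]/= /andP[Ts st0] smin] := @EVT_min R u T t0 Tt0.
  by apply: continuous_subspaceW (@Chalf_cont _ _ u); exact: itvcc_sub_Nyc.
have us1 : u s <= u t1 by apply: smin; rewrite in_itv/= Tt1.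
have umin t : t <= t0 -> u s <= u t <= M.
  move=> tt0; have /andP[_ ->] := u0M t tt0; rewrite andbT.
  have [tT|Tt] := ltP t T; last by apply: smin; rewrite in_itv/= Tt.
  by rewrite (le_trans us1)// ltW// Ku// (lt_le_trans tT).
have us0 : 0 <= u s by have /andP[] := u0M s st0.
have us := @minimum_propagates_left R t0 l0 l1 gamma u G _ M s l0P l1P l10 gP gG
  uP us0 umin st0 erefl.
have rs : T - 1 <= s by rewrite lerBlDr (le_trans Ts)// lerDl.
have TK1 : T - 1 < K by rewrite ltrBlDr (le_lt_trans TK)// ltrDl.
by have := Ku _ TK1; rewrite (us _ rs) => /lt_le_trans/(_ us1); rewrite ltxx.
Qed.

(** Subtracting [(kappa / gamma t0) gamma] from [u] absorbs the term
    [- l1(u)], because [u <= kappa <= (kappa / gamma t0) gamma] and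
    [l1(gamma) <= - gamma']. What is left bounds the derivative below by
    [l0(u) + f(u)], and hence by any minorant [k h] of it. *)
Lemma solution_corrected_integral_le (R : realType) (t0 : R)
    (l0 l1 f : Cloc R -> Lloc R) (gamma u : Chalf t0) (kappa a b k : R)
    (h : Lloc R) :
  volterra_positive t0 l1 -> decay_witness l1 gamma -> solution l0 l1 f u ->
  (forall t, t <= t0 -> 0 <= u t <= kappa) -> 0 <= kappa ->
  {ae @lebesgue_measure R, forall t, t <= t0 ->
    k * h t <= l0 (theta u) t + f (theta u) t} -> 0 < k ->
  let F t := u t - kappa / gamma t0 * gamma t in
  a <= b -> b <= t0 ->
  k * \int[@lebesgue_measure R]_(s in `[a, b]) h s <= F b - F a.
Proof.
move=> l1P gP [acu du] u0k k0 hle kpos F ab bt0.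
have [acg g0 dg] := gP.
have ganti := @decay_witness_antitone R t0 l1 gamma _ _ l1P gP.
set e := kappa / gamma t0 in F *.
have e0 : 0 <= e by rewrite divr_ge0// ltW// g0.
(* Dividing by [k] keeps [h] itself as the minorant of the derivative. *)
pose F' := k^-1 \*: ((u : R -> R) - e \*: (gamma : R -> R)).
suff : \int[@lebesgue_measure R]_(s in `[a, b]) h s <= F' b - F' a.
  rewrite (_ : F' b - F' a = k^-1 * (F b - F a)); first by rewrite ler_pdivlMl.
  by rewrite mulrBr.
have sub := @itvcc_sub_Nyc R a b t0 bt0.
apply: AC_integral_le => //.
  have -> : F' = (fun t => k^-1 * (- e * gamma t + (1 * u t + 0)) + 0).
    apply/funext => r.
    have -> : F' r = k^-1 * (u r - e * gamma r) by [].
    by rewrite mul1r !addr0 addrC mulNr.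
  apply: abs_cont_linear; last exact: abs_cont_cst.
  apply: abs_cont_linear; first exact: acg.
  by apply: abs_cont_linear; [exact: acu|exact: abs_cont_cst].
have W0 r : r <= t0 -> 1 * theta u r <= e * theta gamma r.
  move=> rt0; rewrite !thetaE// mul1r; have /andP[_ uk] := u0k r rt0.
  apply: (le_trans uk); rewrite /e mulrAC ler_pdivlMr ?g0//.
  by rewrite ler_wpM2l// ganti.
have l1U := @volterra_positive_le R t0 l1 t0 1 e _ _ l1P (lexx _) W0.
apply: filterS2 (filterI dg du) (filterI l1U hle).
move=> r [dgr dur] [l1Ur hr] ar /ltW rb.
have rt0 := le_trans rb bt0.
have [dg1 dg2] := dgr rt0; have [du1 du2] := dur rt0.
have deg : derivable (e \*: (gamma : R -> R)) r 1 by exact: derivableZ.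
have due : derivable ((u : R -> R) - e \*: (gamma : R -> R)) r 1.
  exact: derivableB.
split; first exact: derivableZ.
rewrite derive1E deriveZ// deriveB// deriveZ// -!derive1E /GRing.scale/=.
rewrite ler_pdivlMl// du2.
have e1 := l1Ur rt0; have e2 := ler_wpM2l e0 dg2; have e3 := hr rt0.
lra.
Qed.

(** * Vanishing of the limit *)

Theorem theorem2p9 (R : realType) (l0 l1 f : Cloc R -> Lloc R)
  (l0_lin : linear_op l0) (l0_cont : continuous l0) (l0_pos : positive_op l0)
  (l1_lin : linear_op l1) (l1_cont : continuous l1) (l1_pos : positive_op l1)
  (f_cont : continuous f) (f_carath : local_caratheodory f)
  (t0 : R) (l0_volterra : volterra t0 l0) (l1_volterra : volterra t0 l1)
  (l1_le_l0 : {ae @lebesgue_measure R, forall t, t <= t0 ->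
     l1 (Cloc_cst 1) t <= l0 (Cloc_cst 1) t})
  (kappa : R) (kappa_gt0 : 0 < kappa)
  (f_ge0 : forall v : Cloc R, C0 `[0, kappa]%classic v ->
     {ae @lebesgue_measure R, forall t, t <= t0 -> 0 <= f v t})
  (gamma_ex : exists gamma : Chalf t0,
     [/\ AC_loc `]-oo, t0]%classic gamma,
         forall t, t <= t0 -> 0 < gamma t,
         {ae @lebesgue_measure R, forall t, t <= t0 ->
            derivable (gamma : R -> R) t 1 /\
            derive1 gamma t <= - l1 (theta gamma) t} &
         exists2 g : \bar R, limit_ninfty gamma g & (g < +oo)%E])
  (c : R) (c_gt0 : 0 < c) (c_lt_kappa : c < kappa)
  (u : Chalf t0) (u_sol : solution l0 l1 f u) (u_t0 : u t0 = c)
  (u_bnd : forall t, t <= t0 -> 0 <= u t <= kappa)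
  (ul : \bar R) (u_lim : limit_ninfty u ul)
  (alt : (\int[@lebesgue_measure R]_(s in `[t, t0]) (l0 (Cloc_cst 1) s)%:E)%E
             @[t --> -oo] --> +oo%E \/
         exists omega : R -> R, Sigma omega /\ class_O t0 omega kappa c f) :
  ul = 0%E.
Proof.
have l0P : volterra_positive t0 l0 by split.
have l1P : volterra_positive t0 l1 by split.
have [gamma [acg g0 dg [g gl ginfty]]] := gamma_ex.
have gP : decay_witness l1 gamma by split.
have [G gG] : exists G, g = G%:E.
  have : (0%:E <= g)%E.
    by apply: (@limit_ninfty_ge R gamma _ _ t0 gl) => t /g0/ltW.
  by case: g ginfty {gl} => // r; exists r.
subst g.
have gbnd t : t <= t0 -> gamma t <= G.
  move=> tt0; rewrite -lee_fin; apply: (@limit_ninfty_ge R gamma _ _ t gl).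
  by move=> s st; exact: decay_witness_antitone l1P gP st tt0.
have [L uL] : exists L, ul = L%:E.
  have : (0%:E <= ul)%E.
    by apply: (@limit_ninfty_ge R u _ _ t0 u_lim) => t /u_bnd/andP[].
  have : (ul <= kappa%:E)%E.
    by apply: (@limit_ninfty_le R u _ _ t0 u_lim) => t /u_bnd/andP[].
  by case: ul {u_lim} => // r; exists r.
subst ul.
have L0 : 0 <= L.
  rewrite -lee_fin; apply: (@limit_ninfty_ge R u _ _ t0 u_lim).
  by move=> t /u_bnd/andP[].
congr EFin; apply/eqP; rewrite eq_le L0 andbT leNgt; apply/negP => Lpos.
have uLr : u t @[t --> -oo] --> L by exact: fine_cvg u_lim.
have gGr : gamma t @[t --> -oo] --> G by exact: fine_cvg gl.
have thK : C0 `[0, kappa]%classic (theta u).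
  have thb t : 0 <= theta u t <= kappa.
    by rewrite /=; apply: u_bnd; rewrite ge_min lexx orbT.
  split=> [|t]; last by rewrite /= in_itv/=; exact: thb.
  exists kappa; split=> [|M kM t _]; first exact: num_real.
  by have /andP[? uk] := thb t; rewrite /= ger0_norm // (le_trans uk)// ltW.
have fu0 := f_ge0 _ thK.
have [acu du] := u_sol.
have uP : supersolution l0 l1 u.
  split=> //; apply: filterS2 du fu0 => t dut fut tt0.
  have [? ->] := dut tt0; split=> //.
  by rewrite lerDl fut.
have u_ge_L := @limit_le_supersolution R t0 l0 l1 gamma u G kappa L
  l0P l1P l1_le_l0 gP gbnd uP u_bnd uLr.
have l0u (k : R) : (forall t, t <= t0 -> k <= u t) ->
    {ae @lebesgue_measure R, forall t, t <= t0 ->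
       k * l0 (Cloc_cst 1) t <= l0 (theta u) t}.
  move=> ku.
  have H t : t <= t0 -> k * Cloc_cst 1 t <= 1 * theta u t.
    by move=> tt0; rewrite thetaE//=; have := ku t tt0; lra.
  have := @volterra_positive_le R t0 l0 t0 k 1 _ _ l0P (lexx _) H.
  by apply: filterS => t /[swap] tt0 /(_ tt0); rewrite mul1r.
pose F t := u t - kappa / gamma t0 * gamma t.
have Fl : F t @[t --> -oo] --> L - kappa / gamma t0 * G.
  by apply: cvgB => //; apply: cvgMr.
have intF (a b k : R) (h : Lloc R) := @solution_corrected_integral_le R t0 l0 l1 f
  gamma u kappa a b k h l1P gP u_sol u_bnd (ltW kappa_gt0).
have [l0y|[om [[_ om_le] fO]]] := alt.
  have hl0 : {ae @lebesgue_measure R, forall t, t <= t0 ->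
      L * l0 (Cloc_cst 1) t <= l0 (theta u) t + f (theta u) t}.
    apply: filterS2 (l0u L u_ge_L) fu0 => t l0t ft tt0.
    by rewrite (le_trans (l0t tt0))// lerDl ft.
  (* [A] is [1 / L] times an upper bound of [F t0 - F t] over [t <= t0]. *)
  pose A := (F t0 + (kappa / gamma t0) * G) / L.
  move/cvgeyPgt : l0y => /(_ A) [K [_ KA]].
  pose t := Num.min (K - 1) t0.
  have tt0 : t <= t0 by rewrite ge_min lexx orbT.
  have : t < K by rewrite gt_min; apply/orP; left; rewrite ltrBlDr ltrDl.
  move=> /KA; rewrite -[X in (_ < X)%E]fineK; last first.
    by apply: integrable_fin_num => //; exact: Lloc_integrable.
  rewrite lte_fin /A ltr_pdivrMr// [X in _ < X]mulrC ltNge => /negP; apply.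
  apply: le_trans (intF _ _ _ _ hl0 Lpos tt0 (lexx _)) _.
  rewrite lerD2l /F.
  have := ler_wpM2l (divr_ge0 (ltW kappa_gt0) (ltW (g0 t0 (lexx _)))) (gbnd t tt0).
  have /andP[] := u_bnd t tt0.
  lra.
have Lc : L <= c by rewrite -u_t0 u_ge_L.
have : (0 < limf_esup (fun t : R =>
   \int[@lebesgue_measure R]_(s in `[om t, t]) (f (theta u) s)%:E) (ninfty_nbhs R))%E.
  apply: fO => //; first by rewrite thetaE.
  exists L; split => //.
  - apply: cvg_trans u_lim; apply: near_eq_cvg.
    exists t0; split=> [|t /ltW tt0]; first exact: num_real.
    by rewrite thetaE.
  - by split => // t tt0; rewrite thetaE// u_ge_L.
  (* The value [c], taken at [t0], is now the minimum of [u]. *)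
  - move=> Lec t tt0; rewrite thetaE//.
    have u_ge_c r : r <= t0 -> c <= u r <= kappa.
      move=> rt0; rewrite -{1}Lec u_ge_L//=.
      by have /andP[] := u_bnd r rt0.
    exact: (@minimum_propagates_left R t0 l0 l1 gamma u G c kappa t0
      l0P l1P l1_le_l0 gP gbnd uP (ltW c_gt0) u_ge_c (lexx _) u_t0).
rewrite ltNge => /negP; apply.
apply/lee_addgt0Pr => e e0; rewrite add0e.
have e20 : 0 < e / 2 by rewrite divr_gt0.
have /cvgrPdist_lt/(_ _ e20)[K [_ FK]] := Fl.
pose T := Num.min K t0.
apply: (@le_trans _ _ (ereal_sup ((fun t : R => \int[@lebesgue_measure R]_(s in
  `[om t, t]) (f (theta u) s)%:E)%E @` [set t | t < T]))).
  apply: ereal_inf_lbound; exists [set t | t < T] => //.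
  by exists T; split=> //; exact: num_real.
apply: ge_ereal_sup => _ [t /= tT <-].
have [tK tt0] : t < K /\ t < t0 by apply/andP; rewrite -lt_min.
have fle : {ae @lebesgue_measure R, forall t, t <= t0 ->
    1 * f (theta u) t <= l0 (theta u) t + f (theta u) t}.
  have u_ge0 r : r <= t0 -> 0 <= u r by move=> /u_bnd/andP[].
  apply: filterS (l0u 0 u_ge0) => r l0r rt0.
  by have := l0r rt0; lra.
rewrite -[X in (X <= _)%E]fineK; last first.
  by apply: integrable_fin_num => //; exact: Lloc_integrable.
rewrite lee_fin -[X in X <= _]mul1r.
apply: le_trans (intF _ _ _ _ fle ltr01 (om_le t) (ltW tt0)) _.
have := FK _ tK; have := FK _ (le_lt_trans (om_le t) tK).
rewrite /F !ltr_distlC; lra.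
Qed.
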